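(* Let $A,B\in\mathbb{Z}$ with $A\equiv B\equiv 1\pmod 4$, and let $\mathcal{F}_{2,A,B}(x)=x^{4}+Ax^{3}+Bx^{2}+Ax+1$. Put $W_1=B+2-2A$, $W_2=B+2+2A$, $W_3=A^2-4B+8$. Then $\mathcal{F}_{2,A,B}(x)$ is irreducible over $\mathbb{Q}$, and its Galois group over $\mathbb{Q}$ is isomorphic to the cyclic group $C_4$ if and only if $W_1W_2W_3$ is a perfect square, and is isomorphic to the dihedral group $D_4$ of order $8$ if and only if $W_1W_2W_3$ is not a perfect square.
   Context: $C_n$ denotes the cyclic group of order $n$ and $D_n$ the dihedral group of order $2n$. A ''square'' means the square of an integer. *)

(* Defs.v *)
From HB Require Import structures.
From mathcomp Require Import all_boot all_order all_algebra all_fingroup all_solvable all_field.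

Set Implicit Arguments.
Unset Strict Implicit.
Unset Printing Implicit Defensive.

Import GRing.Theory.
Local Open Scope ring_scope.

Definition F2 (A B : int) : {poly int} :=
  'X^4 + A%:P * 'X^3 + B%:P * 'X^2 + A%:P * 'X + 1.

Definition F2Q (A B : int) : {poly rat} := map_poly intr (F2 A B).

Definition W1 (A B : int) : int := B + 2 - 2 * A.
Definition W2 (A B : int) : int := B + 2 + 2 * A.
Definition W3 (A B : int) : int := A ^+ 2 - 4 * B + 8.

Definition is_square (n : int) : Prop := exists m : int, n = m ^+ 2.

(* L is generated over rat by the roots of p: the Galois group of p over rat is
   then Gal(L / rat), and it does not depend on L up to isomorphism. *)
Definition is_splitting_field (p : {poly rat}) (L : splittingFieldType rat) : Prop :=
  splittingFieldFor 1%VS (map_poly (in_alg L) p) {:L}%VS.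

Lemma splitting_field_exists (p : {poly rat}) : p != 0 -> exists L : splittingFieldType rat, is_splitting_field p L.
Proof.
move=> p0.
have [rs Drs] := closed_field_poly_normal (map_poly ratr p : {poly algC}).
have [Qs [QsC [s1 Ds1 gen]]] := num_field_exists rs.
have lc : lead_coef (map_poly ratr p : {poly algC}) != 0.
  by rewrite lead_coef_eq0 map_poly_eq0.
have H : splittingFieldFor 1 (map_poly (in_alg Qs) p) {:Qs}.
  exists s1 => //.
  rewrite -(eqp_map QsC) rmorph_prod /=.
  rewrite -map_poly_comp /=.
  have -> : map_poly (QsC \o in_alg Qs) p = map_poly ratr p.
    by apply: eq_map_poly => x /=; rewrite rmorphZ_num rmorph1 mulr1.
  rewrite Drs -Ds1 big_map.
  under [X in _ %= X]eq_bigr do rewrite rmorphB /= map_polyX map_polyC.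
  exact: eqp_scale.
have ax : SplittingField.axiom Qs.
  exists (map_poly (in_alg Qs) p) => //; apply: (@alg_polyOver _ Qs).
pose S := FieldExt_isSplittingField.Build rat Qs ax.
pose L : splittingFieldType rat := HB.pack Qs S.
by exists L.
Qed.

(* Main.v *)
(* If a, 1/a, b, 1/b are the roots, put u = a - 1/a, v = b - 1/b, P = uv and
   d = (a + 1/a) - (b + 1/b).  Then d^2 = W3 and P^2 = W1 W2 are both 5 modulo 8,
   hence not squares, so some automorphism s negates both d and P; it permutes the
   roots in a 4-cycle, which gives irreducibility.  An automorphism fixing
   c = d P lies in <s>, and one negating c is an involution.  As c^2 = W1 W2 W3,
   the group is <s> if this is a square, and otherwise a negation k of c exists and
   the involutions s k and k generate the group, which has order 8. *)

Require Import Defs.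
From mathcomp Require Import all_boot all_order all_algebra all_fingroup all_solvable all_field.
From mathcomp Require Import ring.

Set Implicit Arguments.
Unset Strict Implicit.
Unset Printing Implicit Defensive.

Import GRing.Theory Num.Theory.
Local Open Scope ring_scope.

(** * Squares among the integers and the rationals *)

Lemma five_mod8_not_square (n : int) : (n = 5 %[mod 8])%Z -> ~ is_square n.
Proof.
move=> n5 [m nm]; rewrite {n}nm in n5.
have: (m ^+ 2 = (m %% 8)%Z ^+ 2 %[mod 8])%Z by rewrite modzXm.
rewrite n5.
(* The residue of [m] lies in [0, 8), so its square is checked case by case; none is 5 modulo 8. *)
have := ltz_pmod m (isT : 0 < 8 :> int); have := modz_ge0 m (isT : 8 != 0 :> int).
case: (m %% 8)%Z => // k _; do 8?[case: k => [|k] //].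
Qed.

(** A root [m] of [n] satisfies |m| <= m^2 = |n|, so a bounded search decides. *)
Lemma is_square_decidable (n : int) : is_square n \/ ~ is_square n.
Proof.
have [/existsP[m /eqP nm]|nex] := boolP [exists m : 'I_`|n|.+1, n == m%:Z ^+ 2].
  by left; exists m%:Z.
right=> -[m nm]; case/existsP: nex.
have m_lt : (`|m| < `|n|.+1)%N.
  by rewrite ltnS nm abszX; case: `|m|%N => // k; rewrite leq_pmull.
by exists (Ordinal m_lt); rewrite /= abszE real_normK ?num_real // nm.
Qed.

(** In lowest terms the squared denominator divides the squared numerator, so the denominator
    divides the numerator and coprimality makes it 1. *)
Lemma rat_sqr_int (q : rat) (n : int) : q ^+ 2 = n%:~R -> is_square n.
Proof.
move=> qn; exists (numq q); apply: (@intr_inj rat).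
have q_int : denq q = 1.
  have: numq q ^+ 2 = n * denq q ^+ 2.
    apply: (@intr_inj rat); rewrite [RHS]intrM !expr2 !intrM -!expr2 -qn -exprMn.
    by rewrite -{2}[q]divq_num_den divfK // intr_eq0 denq_neq0.
  move/(congr1 absz); rewrite abszM !abszX => E.
  have: (`|denq q|%N ^ 2 %| `|numq q|%N ^ 2)%N by rewrite E dvdn_mull.
  rewrite dvdn_pexp2r // => dv.
  have := coprime_num_den q; rewrite coprime_sym /coprime => /eqP.
  by rewrite (gcdn_idPl dv) => h; have := denq_gt0 q; case: (denq q) h => //= k ->.
by rewrite expr2 intrM -expr2 -qn -{1}[q]divq_num_den q_int divr1.
Qed.

Lemma F2Q_map (A B : int) (L : splittingFieldType rat) :
  map_poly (in_alg L) (F2Q A B) =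
  'X^4 + A%:~R * 'X^3 + B%:~R * 'X^2 + A%:~R * 'X + 1.
Proof.
rewrite /F2Q /F2 -map_poly_comp_id0 /= ?mulr0z ?scale0r //.
rewrite !rmorphD !rmorphM /= !map_polyX !map_polyC /= -!in_algE !rmorph_int.
by [].
Qed.

(** * A field generated by two reciprocal pairs of roots, under Vieta's relations *)

Section ReciprocalRoots.

Variables (A B : int) (L : splittingFieldType rat) (a a' b b' : L).
Hypotheses (aa' : a * a' = 1) (bb' : b * b' = 1).
Hypothesis sumE : a + a' + b + b' = - A%:~R.
Hypothesis prodE : (a + a') * (b + b') + 2 = B%:~R.
Hypothesis genL : <<1 & [:: a; a'; b; b']>>%VS = {:L}%VS.
Hypothesis nsq12 : ~ is_square (W1 A B * W2 A B).
Hypothesis nsq3 : ~ is_square (W3 A B).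

Local Notation G := 'Gal({:L} / 1)%g.
Local Notation d := (a + a' - (b + b')).
Local Notation P := ((a - a') * (b - b')).

Lemma L_char0 (n : int) : (n%:~R == 0 :> L) = (n == 0).
Proof. by rewrite -(rmorph_int (in_alg L)) fmorph_eq0 intr_eq0. Qed.

Lemma d_sqr : d ^+ 2 = (W3 A B)%:~R.
Proof.
have -> : (W3 A B)%:~R = A%:~R ^+ 2 - 4 * B%:~R + 8 :> L by rewrite /W3; ring.
rewrite -prodE -[A%:~R]opprK -sumE; ring.
Qed.

(** [P ^+ 2] is the product of the discriminants of X^2 - (a + a')X + 1 and X^2 - (b + b')X + 1. *)
Lemma P_sqr : P ^+ 2 = (W1 A B * W2 A B)%:~R.
Proof.
have -> : (W1 A B * W2 A B)%:~R = (B%:~R + 2) ^+ 2 - 4 * A%:~R ^+ 2 :> L.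
  by rewrite /W1 /W2; ring.
rewrite -prodE -[A%:~R]opprK -sumE.
have -> : P ^+ 2 = ((a + a') ^+ 2 - 4 * (a * a')) * ((b + b') ^+ 2 - 4 * (b * b')) by ring.
rewrite aa' bb'; ring.
Qed.

Lemma int_not_square_neq0 (n : int) : ~ is_square n -> (n%:~R : L) != 0.
Proof.
by move=> nsq; rewrite L_char0; apply/eqP=> n0; apply: nsq; exists 0; rewrite n0.
Qed.

(** [P] nonzero separates each root from its inverse; [d] nonzero separates the two pairs. *)
Lemma roots_uniq : uniq [:: a; a'; b; b'].
Proof.
have := int_not_square_neq0 nsq3; have := int_not_square_neq0 nsq12.
rewrite -P_sqr -d_sqr !expf_eq0 /= mulf_eq0 !subr_eq0 negb_or => /andP[aNa' bNb'] dN.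
(* Equal elements have equal inverses, hence equal sums with their inverses. *)
have sep (x x' y y' : L) : x * x' = 1 -> y * y' = 1 -> x + x' != y + y' -> x != y.
  move=> xx' yy' ne; apply: contraNneq ne => xy; rewrite -xy in yy' *.
  have x0 : x != 0 by apply: contra_eqN xx' => /eqP->; rewrite mul0r eq_sym oner_eq0.
  by rewrite (mulfI x0 (etrans xx' (esym yy'))).
rewrite /= !inE !negb_or aNa' bNb' !andbT /= andbC -andbA /=.
apply/and4P; split.
- by rewrite (sep _ a _ b') // 1?mulrC // addrC.
- by rewrite (sep _ a _ b) // 1?mulrC // addrC [b' + b]addrC.
- by rewrite (sep _ a' _ b').
- by rewrite (sep _ a' _ b) // 1?mulrC // [b' + b]addrC.
Qed.

Lemma F2Q_factor :
  map_poly (in_alg L) (F2Q A B) = \prod_(z <- [:: a; a'; b; b']) ('X - z%:P).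
Proof.
rewrite F2Q_map !big_cons big_nil mulr1.
have -> : A%:~R = - (a%:P + a'%:P + b%:P + b'%:P) :> {poly L}.
  by rewrite -!polyCD sumE polyCN opprK rmorph_int.
have -> : B%:~R = (a%:P + a'%:P) * (b%:P + b'%:P) + 2 :> {poly L}.
  by rewrite -(rmorph_int polyC) -prodE -!polyCD -polyCM rmorphD rmorph_nat.
have aaP : a%:P * a'%:P = 1 :> {poly L} by rewrite -polyCM aa'.
have bbP : b%:P * b'%:P = 1 :> {poly L} by rewrite -polyCM bb'.
have -> : ('X - a%:P) * (('X - a'%:P) * (('X - b%:P) * ('X - b'%:P))) =
  ('X^2 - (a%:P + a'%:P) * 'X + a%:P * a'%:P) *
  ('X^2 - (b%:P + b'%:P) * 'X + b%:P * b'%:P) :> {poly L} by ring.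
rewrite aaP bbP; ring.
Qed.

(** * Automorphisms acting on square roots of integers *)

Lemma galois_L : galois 1 {:L}.
Proof.
apply/splitting_galoisField; exists (map_poly (in_alg L) (F2Q A B)); split.
- exact: alg_polyOver.
- by rewrite F2Q_factor separable_prod_XsubC roots_uniq.
- by exists [:: a; a'; b; b'] => //; rewrite F2Q_factor eqpxx.
Qed.

Lemma gal_sign (x : gal_of {:L}) (z : L) (n : int) :
  z ^+ 2 = n%:~R -> x z = z \/ x z = - z.
Proof.
move=> zn; have/eqP: (x z) ^+ 2 = z ^+ 2 by rewrite -rmorphXn zn rmorph_int.
by rewrite eqf_sqr => /orP[]/eqP; [left | right].
Qed.

(** Otherwise all of [G] fixes [z], which is then rational, and [n] is the square of a rational,
    hence of an integer. *)
Lemma gal_sqrt_moved (z : L) (n : int) : z ^+ 2 = n%:~R -> ~ is_square n ->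
  exists2 x, x \in G & x z = - z.
Proof.
move=> zn nsq.
have [/existsP[x /andP[Gx /eqP]]|] := boolP [exists x, (x \in G) && (x z == - z)].
  by exists x.
rewrite negb_exists => /forallP nex; case: nsq.
have : z \in fixedField G.
  apply/fixedFieldP=> [|x Gx]; first exact: memvf.
  have [//|xz] := gal_sign x zn.
  by have := nex x; rewrite Gx xz eqxx.
rewrite (galois_fixedField galois_L) => /vlineP[q zq].
apply: (@rat_sqr_int q); apply: (fmorph_inj (in_alg L)).
by rewrite rmorphXn rmorph_int /= -zq.
Qed.

(** The roots are rational combinations of d, u, v and the rational number a + a' + b + b', and they
    generate [L]. *)
Lemma gal_eq1 (x : gal_of {:L}) : x d = d -> x (a - a') = a - a' ->
  x (b - b') = b - b' -> x = 1%g.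
Proof.
move=> xd xu xv.
have fx (z : L) : x z = z -> z \in fixedField [set x].
  by move=> xz; apply/fixedFieldP=> [|y /set1P->]; first exact: memvf.
have : (<<1 & [:: a; a'; b; b']>> <= fixedField [set x])%VS.
  apply/Fadjoin_seqP; split; first exact: sub1v.
  have xA : x (a + a' + b + b') = a + a' + b + b' by rewrite sumE rmorphN rmorph_int.
  move: xd xu xv xA; rewrite !(rmorphD, rmorphB, rmorphN) => xd xu xv xA z.
  have tw (y y' : L) : 4 * y = 4 * y' -> y = y'.
    by apply: mulfI; rewrite (L_char0 4).
  rewrite !inE => /or4P[]/eqP->; apply: fx; apply: tw.
  - have -> : 4 * a = (a + a' + b + b') + (a + a' - (b + b')) + 2 * (a - a') by ring.
    rewrite -{}xA -{}xd -{}xu; ring.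
  - have -> : 4 * a' = (a + a' + b + b') + (a + a' - (b + b')) - 2 * (a - a') by ring.
    rewrite -{}xA -{}xd -{}xu; ring.
  - have -> : 4 * b = (a + a' + b + b') - (a + a' - (b + b')) + 2 * (b - b') by ring.
    rewrite -{}xA -{}xd -{}xv; ring.
  - have -> : 4 * b' = (a + a' + b + b') - (a + a' - (b + b')) - 2 * (b - b') by ring.
    rewrite -{}xA -{}xd -{}xv; ring.
rewrite genL => /subvP sub; apply/eqP/gal_eqP=> z _.
by have /(fixedFieldP (memvf z))/(_ _ (set11 x))-> := sub z (memvf z); rewrite gal_id.
Qed.

Lemma d_neq0 : d != 0.
Proof. by have := int_not_square_neq0 nsq3; rewrite -d_sqr expf_eq0. Qed.

Lemma P_neq0 : P != 0.
Proof. by have := int_not_square_neq0 nsq12; rewrite -P_sqr expf_eq0. Qed.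

(** Since d - A = 2(a + a'), u^2 is a rational polynomial in d. Replacing d by -d turns it into v^2,
    so an automorphism negating d exchanges u^2 and v^2. *)
Lemma u_sqr : 4 * (a - a') ^+ 2 = (d - A%:~R) ^+ 2 - 16.
Proof.
have -> : 4 * (a - a') ^+ 2 = 4 * (a + a') ^+ 2 - 16 * (a * a') by ring.
rewrite aa' -sumE; ring.
Qed.

Lemma v_sqr : 4 * (b - b') ^+ 2 = (d + A%:~R) ^+ 2 - 16.
Proof.
have -> : 4 * (b - b') ^+ 2 = 4 * (b + b') ^+ 2 - 16 * (b * b') by ring.
rewrite bb' -[A%:~R]opprK -sumE; ring.
Qed.

Lemma gal_u_fix (x : gal_of {:L}) : x d = d ->
  x (a - a') = a - a' \/ x (a - a') = - (a - a').
Proof.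
move=> xd; suff /eqP : x (a - a') ^+ 2 = (a - a') ^+ 2.
  by rewrite eqf_sqr => /orP[]/eqP; [left | right].
apply: (@mulfI _ 4); first by rewrite (L_char0 4).
have := congr1 x u_sqr.
rewrite rmorphM [RHS]rmorphB [in LHS]rmorphXn [in RHS]rmorphXn /= [x (d - _)]rmorphB /= xd.
by rewrite !rmorph_int !rmorph_nat u_sqr.
Qed.

Lemma gal_u_swap (x : gal_of {:L}) : x d = - d ->
  x (a - a') = b - b' \/ x (a - a') = - (b - b').
Proof.
move=> xd; suff /eqP : x (a - a') ^+ 2 = (b - b') ^+ 2.
  by rewrite eqf_sqr => /orP[]/eqP; [left | right].
apply: (@mulfI _ 4); first by rewrite (L_char0 4).
have := congr1 x u_sqr.
rewrite rmorphM [RHS]rmorphB [in LHS]rmorphXn [in RHS]rmorphXn /= [x (d - _)]rmorphB /= xd.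
by rewrite !rmorph_int !rmorph_nat v_sqr -opprD sqrrN.
Qed.

(** The sign [f] on u is free; the sign on v follows from P = uv. *)
Lemma gal_fix (x : gal_of {:L}) (e : bool) : x d = d -> x P = (-1) ^+ e * P ->
  exists f : bool,
    x (a - a') = (-1) ^+ f * (a - a') /\ x (b - b') = (-1) ^+ (e (+) f) * (b - b').
Proof.
have := P_neq0; rewrite mulf_eq0 negb_or => /andP[u0 v0].
move=> /gal_u_fix xu xP.
have {xu}[f xu] : exists f : bool, x (a - a') = (-1) ^+ f * (a - a').
  by case: xu => ->; [exists false | exists true]; rewrite ?mul1r ?mulN1r.
exists f; split=> //; move: xP; rewrite rmorphM /= xu.
move: (x (b - b')) => w; case: e f {xu} => [] [] /=;
  rewrite ?mul1r ?mulN1r ?mulNr -?mulrN => /(mulfI u0) E;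
  by [exact: E | exact: oppr_inj | rewrite -E opprK].
Qed.

Lemma gal_swap (x : gal_of {:L}) (e : bool) : x d = - d -> x P = (-1) ^+ e * P ->
  exists f : bool,
    x (a - a') = (-1) ^+ f * (b - b') /\ x (b - b') = (-1) ^+ (e (+) f) * (a - a').
Proof.
have := P_neq0; rewrite mulf_eq0 negb_or => /andP[u0 v0].
move=> /gal_u_swap xu xP.
have {xu}[f xu] : exists f : bool, x (a - a') = (-1) ^+ f * (b - b').
  by case: xu => ->; [exists false | exists true]; rewrite ?mul1r ?mulN1r.
exists f; split=> //; move: xP; rewrite rmorphM /= xu [(a - a') * _]mulrC.
move: (x (b - b')) => w; case: e f {xu} => [] [] /=;
  rewrite ?mul1r ?mulN1r ?mulNr -?mulrN => /(mulfI v0) E;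
  by [exact: E | exact: oppr_inj | rewrite -E opprK].
Qed.

Lemma galE (x y : gal_of {:L}) (z : L) : (x * y)%g z = y (x z).
Proof. by rewrite galM ?memvf. Qed.

(** * Orders of automorphisms, sorted by their effect on [c] *)

Local Notation c := (d * P).

Lemma c_sqr : c ^+ 2 = (W1 A B * W2 A B * W3 A B)%:~R.
Proof. by rewrite exprMn d_sqr P_sqr mulrC -intrM. Qed.

Lemma neqN (z : L) : z != 0 -> z != - z.
Proof.
move=> z0; rewrite -subr_eq0 opprK -mulr2n -mulr_natl mulf_neq0 //.
by rewrite (L_char0 2).
Qed.

Lemma c_neqN : c != - c.
Proof.
by rewrite neqN // mulf_neq0 ?d_neq0 ?P_neq0.
Qed.

Lemma gal_cases (x : gal_of {:L}) :
  exists e f : bool, [/\ x d = (-1) ^+ e * d, x P = (-1) ^+ f * P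
    & x c = (-1) ^+ (e (+) f) * c].
Proof.
have [xd|xd] := gal_sign x d_sqr; have [xP|xP] := gal_sign x P_sqr.
- by exists false, false; rewrite [x c]rmorphM /= xd xP !mul1r.
- by exists false, true; rewrite [x c]rmorphM /= xd xP !mul1r !mulN1r mulrN.
- by exists true, false; rewrite [x c]rmorphM /= xd xP !mul1r !mulN1r mulNr.
- by exists true, true; rewrite [x c]rmorphM /= xd xP !mul1r !mulN1r mulrNN.
Qed.

(** Negating [c] means negating exactly one of [d] and [P]. *)
Lemma gal_reflection_sqr (x : gal_of {:L}) : x c = - c -> (x ^+ 2)%g = 1%g.
Proof.
have [e [f [xd xP ->]]] := gal_cases x.
case: e f xd xP => [] [] /=; rewrite ?mul1r ?mulN1r => xd xP;
  try by move/eqP; rewrite (negPf c_neqN).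
(* Here [d] is negated and [P] fixed: u and v are exchanged with one common sign, which squares
   away. *)
- move=> _; have [|g [xu xv]] := @gal_swap x false xd; first by rewrite mul1r.
  move: xu xv; rewrite addFb => xu xv.
  by apply: gal_eq1; rewrite expgS expg1 galE ?xd ?xu ?xv ?rmorphN ?rmorphM
    ?rmorph_sign /= ?xd ?xu ?xv ?opprK // signrMK.
(* Here [d] is fixed and [P] negated: u and v are each only multiplied by a sign. *)
- move=> _; have [|g [xu xv]] := @gal_fix x true xd; first by rewrite mulN1r.
  by apply: gal_eq1; rewrite expgS expg1 galE ?xd ?xu ?xv ?rmorphM
    ?rmorph_sign /= ?xd ?xu ?xv ?signrMK.
Qed.

(** As [P] is negated, u and v are exchanged with opposite signs, so the square negates both. *)
Lemma gal_rotation_sqr (x : gal_of {:L}) : x d = - d -> x P = - P ->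
  [/\ (x ^+ 2)%g d = d, (x ^+ 2)%g (a - a') = - (a - a')
    & (x ^+ 2)%g (b - b') = - (b - b')].
Proof.
move=> xd xP; have [|g [xu xv]] := @gal_swap x true xd; first by rewrite mulN1r.
rewrite expgS expg1 !galE xd xu xv rmorphN !rmorphM !rmorph_sign /= xd xu xv.
by rewrite opprK !addTb !signrN !mulNr !mulrN !signrMK.
Qed.

Lemma gal_rotation_order (x : gal_of {:L}) : x d = - d -> x P = - P -> #[x]%g = 4.
Proof.
move=> xd xP; have [xxd xxu xxv] := gal_rotation_sqr xd xP.
(* It suffices that [x ^+ 2] has order 2: it only negates u and v, and u is nonzero. *)
apply: (@orderXprime _ 2 2) => //; apply: nt_prime_order => //.
  move: (x ^+ 2)%g xxd xxu xxv => y yd yu yv.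
  by apply: gal_eq1; rewrite expgS expg1 galE ?yd // ?yu ?yv rmorphN /= ?yu ?yv opprK.
apply: contraTneq isT => x2; move/eqP: xxu.
have := P_neq0; rewrite mulf_eq0 negb_or => /andP[u0 _].
by rewrite x2 gal_id (negPf (neqN u0)).
Qed.

Lemma gal_fix_c (s x : gal_of {:L}) : s d = - d -> s P = - P ->
  x c = c -> x \in <[s]>%g.
Proof.
move=> sd sP; have [ssd ssu ssv] := gal_rotation_sqr sd sP.
(* Fixing [d] and [P] forces one common sign on u and v: the sign -1 gives the action of [s ^+ 2],
   the sign 1 the identity. *)
have even (y : gal_of {:L}) : y d = d -> y P = P -> y \in <[s]>%g.
  move=> yd yP; have [|[] [yu yv]] := @gal_fix y false yd; rewrite ?mul1r //.
    rewrite -(groupMr _ (mem_cycle s 2)) /= (_ : y * s ^+ 2 = 1)%g ?group1 //.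
    apply: gal_eq1; rewrite galE ?yd // ?yu ?yv /= mulN1r rmorphN /= ?ssu ?ssv.
      by rewrite opprK.
    by rewrite opprK.
  by rewrite (_ : y = 1%g) ?group1 //; apply: gal_eq1; rewrite ?yu ?yv ?mul1r.
have [e [f [xd xP ->]]] := gal_cases x.
case: e f xd xP => [] [] /=; rewrite ?mul1r ?mulN1r => xd xP;
  try by move/eqP; rewrite eq_sym (negPf c_neqN).
all: move=> _.
  2: exact: even.
(* Both [d] and [P] are negated by [x], so [x * s] fixes both. *)
rewrite -(groupMr _ (cycle_id s)).
by apply: even; rewrite galE ?xd ?xP rmorphN /= ?sd ?sP opprK.
Qed.

(** If [g] negates only [d] and [l] negates only [P], their product negates both. *)
Lemma gal_rotation_exists :
  exists s : gal_of {:L}, [/\ s \in G, s d = - d & s P = - P].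
Proof.
have [g Gg gd] := gal_sqrt_moved d_sqr nsq3.
have [l Gl lP] := gal_sqrt_moved P_sqr nsq12.
have [gP|gP] := gal_sign g P_sqr; last by exists g.
have [ld|ld] := gal_sign l d_sqr; last by exists l.
by exists (g * l)%g; rewrite groupM // !galE gd gP lP rmorphN /= ld.
Qed.

(** * Identification of the Galois group *)

Lemma gal_square : is_square (W1 A B * W2 A B * W3 A B) ->
  (G \isog [set: 'Z_4])%g.
Proof.
move=> [m mE]; have [s [Gs sd sP]] := gal_rotation_exists.
have GE : G = <[s]>%g :> {set _}.
  apply/eqP; rewrite eqEsubset cycle_subG Gs andbT; apply/subsetP=> x _.
  apply: (gal_fix_c sd sP).
  (* [c] equals [m] or its opposite, so it is rational and fixed by every automorphism. *)
  have /eqP : c ^+ 2 = m%:~R ^+ 2 by rewrite c_sqr mE expr2 intrM.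
  by rewrite eqf_sqr => /orP[]/eqP ->; rewrite ?rmorphN /= rmorph_int.
rewrite GE isog_cyclic_card ?cycle_cyclic //.
by rewrite -orderE (gal_rotation_order sd sP) cardsT card_ord /= Zp_cycle cycle_cyclic.
Qed.

Lemma gal_nonsquare : ~ is_square (W1 A B * W2 A B * W3 A B) ->
  (G \isog 'D_8)%g.
Proof.
move=> nsq; have [s [Gs sd sP]] := gal_rotation_exists.
have [k Gk kc] := gal_sqrt_moved c_sqr nsq.
have sc : s c = c by rewrite rmorphM /= sd sP mulrNN.
have skc : (s * k)%g c = - c by rewrite galE sc.
have involution (x : gal_of {:L}) : x c = - c -> #[x]%g = 2.
  move=> xc; apply: nt_prime_order => //; first exact: gal_reflection_sqr.
  by apply: contra_eq_neq xc => ->; rewrite gal_id c_neqN.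
(* Every power of [s] fixes [c], while [k] negates it. *)
have kNs : k \notin <[s]>%g.
  apply: contra_eqN kc => /cycleP[i ->].
  suff -> : (s ^+ i)%g c = c by apply: c_neqN.
  by elim: i => [|i IH]; rewrite ?expg0 ?gal_id // expgS galE sc.
(* Either [x] or [x * k] fixes [c], hence lies in [<[s]>]. *)
have GE : (<[s]> * <[k]>)%g = G.
  apply/eqP; rewrite eqEsubset mul_subG ?cycle_subG //=; apply/subsetP=> x _.
  have [xc|xc] := gal_sign x c_sqr.
    by rewrite -[x]mulg1 mem_mulg ?group1 // (gal_fix_c sd sP).
  rewrite -[x](mulgK k) mem_mulg ?groupV ?cycle_id //.
  by apply: (gal_fix_c sd sP); rewrite galE xc rmorphN /= kc opprK.
(* [<[k]>] has prime order and [k] is outside [<[s]>], so the two meet trivially and the order is 4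
   * 2. *)
have cardG : #|G| = 8.
  have := mul_cardG <[s]> <[k]>.
  rewrite GE -!orderE (gal_rotation_order sd sP) involution // setIC prime_TIg.
  - by rewrite cards1 muln1 => <-.
  - by rewrite -orderE involution.
  - by rewrite cycle_subG.
have genG : <<[set (s * k)%g; k]>>%g = G.
  apply/eqP; rewrite eqEsubset gen_subG; apply/andP; split.
    by apply/subsetP=> x /set2P[] ->; rewrite ?groupM.
  have kin : k \in <<[set (s * k)%g; k]>>%g by rewrite mem_gen ?set22.
  rewrite -{1}GE mul_subG // cycle_subG //.
  by rewrite -(groupMr _ kin) mem_gen ?set21.
have := @involutions_gen_dihedral _ (s * k)%g k (involution _ skc) (involution _ kc).
rewrite /= genG cardG; apply.
(* The two involutions are distinct, since [s * k = k] would make [s] trivial. *)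
apply/eqP=> skk.
by have := gal_rotation_order sd sP; rewrite -[s](mulgK k) skk mulgV order1.
Qed.

(** * Irreducibility from a 4-cycle on the roots *)

Lemma gal_rotation_cycle (s : gal_of {:L}) : s d = - d -> s P = - P ->
  [/\ s a = b, s b = a', s a' = b' & s b' = a] \/
  [/\ s a = b', s b' = a', s a' = b & s b = a].
Proof.
move=> sd sP; have [|f [su sv]] := @gal_swap s true sd; first by rewrite mulN1r.
have sS : s (a + a' + b + b') = a + a' + b + b' by rewrite sumE rmorphN rmorph_int.
move: sd su sv sS; rewrite !(rmorphD, rmorphB, rmorphN) /=.
move: (s a) (s a') (s b) (s b') => ra ra' rb rb' sd su sv sS.
have tw (y y' : L) : 4 * y = 4 * y' -> y = y'.
  by apply: mulfI; rewrite (L_char0 4).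
have ea : 4 * ra = (ra + ra' + rb + rb') + (ra + ra' - (rb + rb')) + 2 * (ra - ra').
  by ring.
have ea' : 4 * ra' = (ra + ra' + rb + rb') + (ra + ra' - (rb + rb')) - 2 * (ra - ra').
  by ring.
have eb : 4 * rb = (ra + ra' + rb + rb') - (ra + ra' - (rb + rb')) + 2 * (rb - rb').
  by ring.
have eb' : 4 * rb' = (ra + ra' + rb + rb') - (ra + ra' - (rb + rb')) - 2 * (rb - rb').
  by ring.
rewrite sS sd su sv in ea ea' eb eb'.
(* The sign [f] decides the direction of the cycle. *)
by case: f ea ea' eb eb' {sd su sv sS} => /= ea ea' eb eb'; [right | left]; split;
  apply: tw; rewrite ?ea ?ea' ?eb ?eb'; ring.
Qed.

Lemma root_gal (s : gal_of {:L}) (q : {poly rat}) (z : L) :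
  root (map_poly (in_alg L) q) z -> root (map_poly (in_alg L) q) (s z).
Proof.
move=> /rootP qz.
have -> : map_poly (in_alg L) q = map_poly s (map_poly (in_alg L) q).
  by rewrite -map_poly_comp; apply: eq_map_poly => r /=; rewrite linearZ /= rmorph1.
by apply/rootP; rewrite horner_map qz rmorph0.
Qed.

(** A nonconstant divisor has one of the four roots; the 4-cycle carries it to all of them, and they
    are distinct. *)
Lemma F2Q_irreducible : irreducible_poly (F2Q A B).
Proof.
split=> [|q q1 qF].
  by rewrite -(size_map_poly (in_alg L)) F2Q_factor size_prod_XsubC.
have [s [_ sd sP]] := gal_rotation_exists.
have := qF; rewrite -(dvdp_map (in_alg L)) F2Q_factor => dv.
have [m qm] := dvdp_prod_XsubC dv.
have [z zrs qz] : exists2 z, z \in [:: a; a'; b; b'] & root (map_poly (in_alg L) q) z.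
  (* A divisor of a product of linear factors is, up to a scalar, a subproduct; the empty one is
     excluded as [q] is not constant. *)
  case Dm: (mask m [:: a; a'; b; b']) qm => [|z t] qm.
    move/eqp_size: qm; rewrite big_nil size_poly1 size_map_poly => q1'.
    by rewrite q1' in q1.
  exists z; first by apply: (@mem_mask _ _ m); rewrite Dm mem_head.
  by rewrite (eqp_root qm) root_prod_XsubC mem_head.
rewrite /eqp qF -(dvdp_map (in_alg L)) F2Q_factor uniq_roots_dvdp //; last first.
  by rewrite uniq_rootsE roots_uniq.
have qs := root_gal s.
(* At most three applications of [s] lead from [z] to [a]. *)
have Ra : root (map_poly (in_alg L) q) a.
  case: (gal_rotation_cycle sd sP) => -[s1 s2 s3 s4];
  by move: zrs qz; rewrite !inE => /or4P[] /eqP-> // /qs; rewrite ?s1 ?s2 ?s3 ?s4 //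
    => /qs; rewrite ?s1 ?s2 ?s3 ?s4 // => /qs; rewrite ?s1 ?s2 ?s3 ?s4.
case: (gal_rotation_cycle sd sP) => -[s1 s2 s3 s4];
  have R1 := qs _ _ Ra; have R2 := qs _ _ R1; have R3 := qs _ _ R2;
  by move: R1 R2 R3; rewrite s1 s2 s3 /= Ra => -> -> ->.
Qed.

End ReciprocalRoots.

(** * Reciprocal pairs of roots in an arbitrary splitting field *)

Lemma splitting_field_roots (A B : int) (L : splittingFieldType rat) :
  is_splitting_field (F2Q A B) L ->
  exists a a' b b' : L, [/\ a * a' = 1, b * b' = 1,
    a + a' + b + b' = - A%:~R, (a + a') * (b + b') + 2 = B%:~R
    & <<1 & [:: a; a'; b; b']>>%VS = {:L}%VS].
Proof.
move=> [rs Drs genrs].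
(* An empty [rs] would make the polynomial constant, but its coefficient of degree 4 is 1. *)
have [a rs_a] : exists a, a \in rs.
  case: rs Drs {genrs} => [/eqp_size|a rs _ ]; last by exists a; rewrite mem_head.
  rewrite big_nil size_poly1 => F1.
  have : (map_poly (in_alg L) (F2Q A B))`_4 = 0 by rewrite nth_default ?F1.
  rewrite F2Q_map -!(rmorph_int polyC) !(coefD, coefCM, coefXn, coefX, coef1) /=.
  by move/eqP; rewrite !mulr0 !addr0 oner_eq0.
have Fa : root (map_poly (in_alg L) (F2Q A B)) a.
  by rewrite (eqp_root Drs) root_prod_XsubC.
have := rootP Fa; rewrite F2Q_map -!(rmorph_int polyC) !hornerE /= => Fa0.
have a0 : a != 0.
  by apply: contra_eqN Fa0 => /eqP->; rewrite !(expr0n, mulr0, mul0r, add0r) oner_eq0.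
(* Comparing coefficients of X^3 in (X^2 - (a + 1/a)X + 1)(X^2 + tX + 1) gives [t]; [tB] is the
   comparison for X^2. *)
set t := A%:~R + (a + a^-1).
have tB : 2 - (a + a^-1) * t = B%:~R.
  apply: (@mulfI _ (a ^+ 2)); first by rewrite expf_neq0.
  apply/eqP; rewrite -subr_eq0 -oppr_eq0 -[X in _ == X]Fa0 /t; apply/eqP; field.
  exact: a0.
have dv : 'X^2 + t%:P * 'X + 1 %| \prod_(z <- rs) ('X - z%:P).
  rewrite -(eqp_dvdr _ Drs) F2Q_map.
  have -> : A%:~R = t%:P - (a%:P + (a^-1)%:P) :> {poly L}.
    by rewrite /t !polyCD addrK rmorph_int.
  have -> : B%:~R = 2 - (a%:P + (a^-1)%:P) * t%:P :> {poly L}.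
    by rewrite -(rmorph_int polyC) -tB rmorphB rmorph_nat rmorphM rmorphD.
  apply/dvdpP; exists ('X^2 - (a%:P + (a^-1)%:P) * 'X + 1).
  ring.
have [m qm] := dvdp_prod_XsubC dv.
have q_size : size ('X^2 + t%:P * 'X + 1 : {poly L}) = 3.
  rewrite -addrA size_polyDl size_polyXn // -cons_poly_def size_cons_poly.
  by case: ifP => // _; rewrite ltnS size_polyC; case: (_ != _).
have q_monic : 'X^2 + t%:P * 'X + 1 \is @monic L.
  rewrite monicE lead_coefE q_size /=.
  by rewrite !(coefD, coefCM, coefXn, coefX, coef1) /= mulr0 !addr0.
(* The quadratic cofactor is a subproduct over [rs], and its size 3 leaves exactly two roots. *)
case Dm: (mask m rs) qm => [|b [|b' [|z r]]] qm; have := eqp_size qm;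
  rewrite q_size size_prod_XsubC // => _.
have {qm} : 'X^2 + t%:P * 'X + 1 = ('X - b%:P) * ('X - b'%:P).
  apply/eqP; rewrite -eqp_monic ?monicMl ?monicXsubC //.
  by move: qm; rewrite !big_cons big_nil mulr1.
move=> qE.
(* Evaluation at 0 gives the product of the roots, and evaluation at 1 then gives their sum. *)
have bb' : b * b' = 1.
  have := congr1 (horner^~ 0) qE; rewrite !hornerE /=.
  by rewrite expr0n add0r mulrNN => <-.
have tE : b + b' = - t.
  have := congr1 (horner^~ 1) qE; rewrite !hornerE /=.
  have -> : (1 - b) * (1 - b') = 1 - (b + b') + b * b' by ring.
  rewrite bb' => h; have -> : b + b' = 2 - (1 - (b + b') + 1) by ring.
  rewrite -h /t; ring.
have aa' : a * a^-1 = 1 by rewrite divff.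
have sumE : a + a^-1 + b + b' = - A%:~R by rewrite -addrA tE /t; ring.
have prodE : (a + a^-1) * (b + b') + 2 = B%:~R by rewrite tE mulrN addrC.
exists a, a^-1, b, b'; split=> //.
(* [rs] generates [L], and by the factorisation each of its members is among the four roots. *)
apply/eqP; rewrite eqEsubv subvf -genrs; apply/Fadjoin_seqP.
split=> [|z rs_z]; first exact: sub1v.
apply: seqv_sub_adjoin.
rewrite -root_prod_XsubC -(F2Q_factor aa' bb' sumE prodE).
by rewrite (eqp_root Drs) root_prod_XsubC.
Qed.

(* MathComp's 'D_8 is the dihedral group of order 8. *)
Theorem theorem1p2 (A B : int)
    (hA : (A = 1 %[mod 4])%Z) (hB : (B = 1 %[mod 4])%Z) :
  irreducible_poly (F2Q A B) /\
  forall L : splittingFieldType rat, is_splitting_field (F2Q A B) L ->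
    ('Gal({:L}%VS / 1%VS) \isog [set: 'Z_4]
       <-> is_square (W1 A B * W2 A B * W3 A B)) /\
    ('Gal({:L}%VS / 1%VS) \isog 'D_8
       <-> ~ is_square (W1 A B * W2 A B * W3 A B)).
Proof.
have ABmod n : (n = 1 %[mod 4])%Z -> exists k, n = k * 4 + 1.
  by move=> n1; exists (n %/ 4)%Z; rewrite {1}(divz_eq n 4) n1.
have [k Ak] := ABmod A hA; have [l Bl] := ABmod B hB.
have nsq12 : ~ is_square (W1 A B * W2 A B).
  apply: five_mod8_not_square.
  have -> : W1 A B * W2 A B = (2 * l ^+ 2 + 3 * l - 8 * k ^+ 2 - 4 * k) * 8 + 5.
    by rewrite /W1 /W2 Ak Bl; ring.
  by rewrite modzMDl.
have nsq3 : ~ is_square (W3 A B).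
  apply: five_mod8_not_square.
  have -> : W3 A B = (2 * k ^+ 2 + k - 2 * l) * 8 + 5.
    by rewrite /W3 Ak Bl; ring.
  by rewrite modzMDl.
split=> [|L /splitting_field_roots [a [a' [b [b' [aa' bb' sumE prodE genL]]]]]].
  have F0 : F2Q A B != 0.
    (* The value at 0 is 1. *)
    apply: contraTneq isT => F0; have := congr1 (horner^~ 0) F0.
    rewrite /F2Q /F2 !(rmorphD, rmorphM) /= !map_polyX !map_polyC /= !hornerE /=.
    by rewrite !(mulr0, mul0r, add0r) => /eqP; rewrite oner_eq0.
  have [L /splitting_field_roots [a [a' [b [b' [aa' bb' sumE prodE genL]]]]]] :=
    splitting_field_exists F0.
  exact: (F2Q_irreducible aa' bb' sumE prodE genL nsq12 nsq3).
have sqZ := gal_square aa' bb' sumE prodE genL nsq12 nsq3.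
have nsqD := gal_nonsquare aa' bb' sumE prodE genL nsq12 nsq3.
(* The remaining implications hold because the two groups have different orders, 4 and 8. *)
split; split=> //.
- move=> isoZ; have [//|nsq] := is_square_decidable (W1 A B * W2 A B * W3 A B).
  have := card_isog (nsqD nsq).
  by rewrite (card_isog isoZ) [RHS](@card_2dihedral 3 isT) cardsT card_ord.
- move=> isoD sq; have := card_isog (sqZ sq).
  by rewrite (card_isog isoD) [LHS](@card_2dihedral 3 isT) cardsT card_ord.
Qed.
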